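(* Let $x_1,x_2,\ldots$ be points of $\mathbb{R}^d$. For every $n\in\mathbb{N}$ and every MAP partition $\hat{\mathcal J}(x_1,\ldots,x_n)$ of $[n]$: if $J_1,J_2\in\hat{\mathcal J}(x_1,\ldots,x_n)$, $J_1\neq J_2$, and $A_k$ denotes the convex hull of the set $\{x_i: i\in J_k\}$ for $k=1,2$, then $A_1\cap A_2$ is either the empty set or a singleton $\{x_i\}$ for some $i\le n$.
   Context: Fix $d\ge 1$, $\alpha>0$ and symmetric positive definite matrices $T,\Sigma\in\mathbb{R}^{d\times d}$. Put $C=\alpha/\sqrt{\det T}$, $R=\Sigma^{-1/2}$ and $R_m=(\Sigma^{-1}+T^{-1}/m)^{1/2}$ for $m\in\mathbb{N}$ (symmetric positive definite square roots); $\|\cdot\|$ is the Euclidean norm and $[n]=\{1,\ldots,n\}$. For $\mathbf{x}=(x_1,\ldots,x_n)\in(\mathbb{R}^d)^n$, nonempty $J\subseteq[n]$, let $\overline{\mathbf{x}_J}=\frac1{|J|}\sum_{j\in J}x_j$. For a partition $\mathcal J$ of $[n]$ into nonempty sets (clusters) let $$Q_{\mathbf{x}}(\mathcal J)=C^{|\mathcal J|}\prod_{J\in\mathcal J}\frac{|J|!}{|J|^{(d+2)/2}\det R_{|J|}}\cdot\exp\Big\{\frac12\sum_{J\in\mathcal J}|J|\cdot\big\|R_{|J|}^{-1}R^2\,\overline{\mathbf{x}_J}\big\|^2\Big\}.$$ Up to a factor not depending on $\mathcal J$, this is the posterior probability of $\mathcal J$ given $\mathbf{x}$ in the Gaussian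 mixture model in which $\mathcal J$ follows the Chinese Restaurant Process with parameter $\alpha$, cluster means are i.i.d. $\mathcal N(0,T)$, and given its cluster mean $\theta$ each observation of a cluster is independently $\mathcal N(\theta,\Sigma)$. A MAP (maximal a posteriori) partition $\hat{\mathcal J}(x_1,\ldots,x_n)$ is any partition of $[n]$ maximising $Q_{\mathbf{x}}$. *)

(* Defs.v *)
From HB Require Import structures.
From mathcomp Require Import all_boot all_order all_algebra.
From mathcomp Require Import all_classical all_reals all_analysis.

Set Implicit Arguments.
Unset Strict Implicit.
Unset Printing Implicit Defensive.

Import Order.TTheory GRing.Theory Num.Theory.
Local Open Scope classical_set_scope.
Local Open Scope ring_scope.

Definition spdmx (R : realType) (d : nat) (A : 'M[R]_d) : Prop :=
  A^T = A /\ forall v : 'cV[R]_d, v != 0 -> 0 < (v^T *m A *m v) 0 0.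

(* A symmetric positive definite A has exactly one symmetric positive definite
   square root, which is then the value chosen here; the default 0 only occurs
   when A is not symmetric positive definite. *)
Definition sqrtmx (R : realType) (d : nat) (A : 'M[R]_d) : 'M[R]_d :=
  xget 0 [set S | spdmx S /\ S *m S = A].

(* The Euclidean norm: `|v| on matrices is the sup norm. *)
Definition norm2 (R : realType) (d : nat) (v : 'cV[R]_d) : R :=
  Num.sqrt (\sum_(i < d) v i 0 ^+ 2).

Definition conv_hull (R : realType) (d : nat) (A : set 'cV[R]_d) :
    set 'cV[R]_d :=
  smallest (@convex_set R 'cV[R]_d) A.

Section Model.
Context (R : realType) (d : nat) (alpha : R) (T Sigma : 'M[R]_d).

Definition crpC : R := alpha / Num.sqrt (\det T).

Definition Rmx : 'M[R]_d := sqrtmx (invmx Sigma).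

(* Only meaningful for 0 < m: here 0^-1 = 0. *)
Definition Rmxn (m : nat) : 'M[R]_d :=
  sqrtmx (invmx Sigma + m%:R^-1 *: invmx T).

Definition cluster_mean (n : nat) (x : 'I_n -> 'cV[R]_d) (J : {set 'I_n}) :
    'cV[R]_d :=
  #|J|%:R^-1 *: \sum_(j in J) x j.

(* The unnormalised posterior probability of the partition P given x when P
   follows the Chinese restaurant process with parameter alpha, the cluster
   means are i.i.d. N(0, T), and each observation of a cluster with mean theta
   is N(theta, Sigma). *)
Definition Qpost (n : nat) (x : 'I_n -> 'cV[R]_d) (P : {set {set 'I_n}}) : R :=
  crpC ^+ #|P|
  * (\prod_(J in P)
       ((#|J|)`!%:R
        / ((#|J|%:R `^ ((d%:R + 2) / 2)) * \det (Rmxn #|J|))))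
  * expR (2^-1 * \sum_(J in P)
       #|J|%:R
       * norm2 (invmx (Rmxn #|J|) *m (Rmx *m Rmx) *m cluster_mean x J) ^+ 2).

Definition MAP_partition (n : nat) (x : 'I_n -> 'cV[R]_d)
    (P : {set {set 'I_n}}) : Prop :=
  finset.partition P [set: 'I_n]%SET /\
  forall P' : {set {set 'I_n}},
    finset.partition P' [set: 'I_n]%SET -> Qpost x P' <= Qpost x P.

End Model.

(* Main.v *)
Require Import Defs.
From mathcomp Require Import all_boot all_order all_algebra.
From mathcomp Require Import all_classical all_reals all_analysis.
From mathcomp Require Import perm complex ring lra.
Import Order.TTheory GRing.Theory Num.Theory.
Local Open Scope classical_set_scope.
Local Open Scope ring_scope.

(** Exchange a point [x i] of [J1] with a point [x j] of [J2]. Cluster sizes do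
    not change, so only the exponent of the posterior does. As a function of
    [v = x j - x i], its change is a linear form [w *m v], where [w]
    depends on the two clusters but not on [i] and [j], plus a quadratic form,
    which is positive for [v != 0]. At a MAP partition the change is at most 0,
    hence [w *m x j < w *m x i] unless [x i = x j]
    ([MAP_clusters_separated]).

    So one linear form separates the two clusters strictly, up to common
    points. If the clusters have no common point, then every value of the form
    on the first hull exceeds every value on the second, and the hulls are
    disjoint. If [a] is a common point, then [a] is the only point of the first
    hull where the form is at most [w *m a] and the only point of the second
    where it is at least that, and the hulls meet exactly in [a]
    ([conv_hull_separated]).

    That the quadratic form is positive and that the prefactor of the
    posterior is positive both need the matrices [Rmxn T Sigma m] to be
    positive definite, that is, a positive definite matrix to have a positive
    definite square root ([spdmx_sqrt_exists]). By the spectral theorem over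
    the complex numbers, a real polynomial that vanishes on the (real)
    eigenvalues of a real symmetric matrix annihilates that matrix
    ([symmetric_spectrum]); so interpolating a root function on the spectrum
    by a real polynomial yields the root as a polynomial in the matrix. *)

(** * Square roots of positive definite matrices *)

Lemma lagrange_interpolation {F : fieldType} (f : F -> F) (s : seq F) :
  exists q : {poly F}, forall a, a \in s -> q.[a] = f a.
Proof.
elim: s => [|a s [q qE]]; first by exists 0.
have [/qE qa|aNs] := boolP (a \in s).
  by exists q => b; rewrite inE => /predU1P[->|/qE].
pose w := \prod_(b <- s) ('X - b%:P).
have wa0 : w.[a] != 0 by rewrite -/(root w a) root_prod_XsubC.
exists (q + ((f a - q.[a]) / w.[a])%:P * w) => b.
rewrite !hornerE inE; case: (eqVneq b a) => [-> _|_ /= bs].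
  by rewrite divfK// subrKC.
have /rootP-> : root w b by rewrite root_prod_XsubC.
by rewrite mulr0 addr0 qE.
Qed.

Lemma trmx_horner_mx {R : comNzRingType} {n : nat} (A : 'M[R]_n.+1)
    (p : {poly R}) :
  (horner_mx A p)^T = horner_mx A^T p.
Proof.
elim/poly_ind: p => [|p c IH]; first by rewrite !rmorph0 trmx0.
rewrite !rmorphD !rmorphM /= !horner_mx_X !horner_mx_C linearD /= tr_scalar_mx.
by rewrite trmx_mul IH; congr (_ + _); exact/comm_mx_horner/comm_mx_refl.
Qed.

(** The spectral theorem in a form free of complex numbers: [s] lists the
    entries of the diagonal form, which are real, and a polynomial acts on a
    diagonalised matrix entrywise. *)
Lemma symmetric_spectrum {R : rcfType} {n : nat} {A : 'M[R]_n.+1} :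
  A^T = A ->
  exists s : seq R, (forall a, a \in s -> eigenvalue A a) /\
    forall p : {poly R}, (forall a, a \in s -> root p a) -> horner_mx A p = 0.
Proof.
move=> AT; pose toC := real_complex R.
pose Ac : 'M[R[i]]_n.+1 := map_mx toC A.
have Ah : Ac \is hermsymmx.
  apply: realsym_hermsym.
    apply/is_hermitianmxP; rewrite expr0 scale1r.
    by apply/matrixP => i j; rewrite !mxE -{1}AT mxE.
  by apply/mxOverP => i j; rewrite mxE complex_real.
pose U := spectralmx Ac; pose l := spectral_diag Ac.
have Uu : U \in unitmx by exact: spectral_unit.
have lR i : toC (complex.Re (l 0 i)) = l 0 i.
  by apply: RRe_real; have /mxOverP := hermitian_spectral_diag_real Ah; apply.
have AE : Ac = invmx U *m diag_mx l *m U.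
  exact/orthomx_spectralP/hermitian_normalmx.
exists [seq complex.Re (l 0 i) | i : 'I_n.+1]; split=> [a|p p0].
  case/mapP => i _ ->; rewrite eigenvalue_root_char -(fmorph_root toC).
  rewrite map_char_poly -eigenvalue_root_char [X in eigenvalue _ X]lR.
  apply/eigenvalueP; exists (row i U).
    rewrite -row_mul [X in U *m X]AE !mulmxA mulmxV// mul1mx.
    by rewrite row_mul row_diag_mx -scalemxAl -rowE.
  apply: contraTneq Uu => Ui0; rewrite unitmxE unitfE negbK.
  rewrite (expand_det_row _ i) big1// => j _.
  by have /rowP/(_ j) := Ui0; rewrite !mxE => ->; rewrite mul0r.
apply: (@map_mx_inj _ _ toC) => //.
rewrite map_mx0 map_horner_mx -/Ac AE horner_mx_uconjC//.
rewrite horner_mx_diag (_ : map_mx _ _ = 0) ?diag_mx0 ?mulmx0 ?mul0mx//.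
  by rewrite linear0 mulmx0 mul0mx.
apply/rowP => i; rewrite !mxE -lR horner_map.
suff /p0/rootP-> :
    complex.Re (l 0 i) \in [seq complex.Re (l 0 i) | i : 'I_n.+1].
  exact: rmorph0.
by apply/mapP; exists i; rewrite ?mem_enum.
Qed.

Lemma spdmx_unit {R : realType} {d : nat} {A : 'M[R]_d} :
  spdmx A -> A \in unitmx.
Proof.
case=> _ Apos; rewrite unitmxE unitfE -det_tr; apply/det0P => -[v v0 vA].
have := Apos v^T; rewrite trmx_eq0 trmxK v0 -mulmxA -[A *m _]trmxK trmx_mul.
by rewrite trmxK vA trmx0 mulmx0 mxE ltxx => /(_ isT).
Qed.

Lemma spdmx_inv {R : realType} {d : nat} {A : 'M[R]_d} :
  spdmx A -> spdmx (invmx A).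
Proof.
move=> As; have Au := spdmx_unit As; case: As => AT Apos; split.
  by rewrite trmx_inv AT.
move=> v v0; have := Apos (invmx A *m v); rewrite trmx_mul trmx_inv AT.
rewrite -!mulmxA mulKVmx// ?mulmxA; apply.
by apply: contra_neq v0 => w0; rewrite -[v](mulKVmx Au) w0 mulmx0.
Qed.

Lemma spdmxD {R : realType} {d : nat} {A B : 'M[R]_d} :
  spdmx A -> spdmx B -> spdmx (A + B).
Proof.
move=> [AT Apos] [BT Bpos]; split=> [|v v0]; first by rewrite linearD /= AT BT.
by rewrite mulmxDr mulmxDl mxE addr_gt0 ?Apos ?Bpos.
Qed.

Lemma spdmxZ {R : realType} {d : nat} {c : R} {A : 'M[R]_d} :
  0 < c -> spdmx A -> spdmx (c *: A).
Proof.
move=> c0 [AT Apos]; split=> [|v v0]; first by rewrite linearZ /= AT.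
by rewrite -scalemxAr -scalemxAl mxE mulr_gt0 ?Apos.
Qed.

Lemma norm2_sqr {R : realType} {d : nat} (v : 'cV[R]_d) :
  norm2 v ^+ 2 = (v^T *m v) 0 0.
Proof.
rewrite sqr_sqrtr ?sumr_ge0// => [|i _]; last exact: sqr_ge0.
by rewrite mxE; apply: eq_bigr => i _; rewrite mxE expr2.
Qed.

Lemma norm2_sqr_gt0 {R : realType} {d : nat} (v : 'cV[R]_d) :
  v != 0 -> 0 < norm2 v ^+ 2.
Proof.
move=> v0; rewrite sqr_sqrtr ?sumr_ge0// => [|i _]; last exact: sqr_ge0.
rewrite lt_neqAle sumr_ge0 ?andbT => [|i _]; last exact: sqr_ge0.
apply: contra_neq v0 => /esym/eqP; rewrite psumr_eq0 => [/allP v0|i _].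
  apply/colP => i; rewrite mxE; apply/eqP; rewrite -sqrf_eq0.
  by apply: v0; rewrite mem_index_enum.
exact: sqr_ge0.
Qed.

Lemma spdmx_eigenvalue_gt0 {R : realType} {d : nat} {A : 'M[R]_d} {a : R} :
  spdmx A -> eigenvalue A a -> 0 < a.
Proof.
move=> [_ Apos] /eigenvalueP[v vA v0].
have := Apos v^T; rewrite trmx_eq0 trmxK v0 vA -scalemxAl mxE => /(_ isT).
have /norm2_sqr_gt0 : v^T != 0 by rewrite trmx_eq0.
by rewrite norm2_sqr trmxK => vv; rewrite pmulr_lgt0.
Qed.

Lemma spdmx_sqr {R : realType} {d : nat} {B : 'M[R]_d} :
  B^T = B -> B \in unitmx -> spdmx (B *m B).
Proof.
move=> BT Bu; split=> [|v v0]; first by rewrite trmx_mul BT.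
have -> : v^T *m (B *m B) *m v = (B *m v)^T *m (B *m v).
  by rewrite trmx_mul BT !mulmxA.
rewrite -norm2_sqr norm2_sqr_gt0//.
by apply: contra_neq v0 => Bv; rewrite -[v](mulKmx Bu) Bv mulmx0.
Qed.

(** Interpolating a fourth root [B] rather than a square root makes positivity
    free: the square of a symmetric invertible matrix is positive definite. *)
Lemma spdmx_sqrt_exists {R : realType} {d : nat} {A : 'M[R]_d} :
  spdmx A -> exists S, spdmx S /\ S *m S = A.
Proof.
case: d A => [|d] A As.
  by exists A; split; rewrite ?[LHS]flatmx0 ?[RHS]flatmx0.
have [s [sA As0]] := symmetric_spectrum (proj1 As).
have [q qE] := lagrange_interpolation (fun a => Num.sqrt (Num.sqrt a)) s.
pose B := horner_mx A q.
have BT : B^T = B by rewrite trmx_horner_mx (proj1 As).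
have B4 : (B *m B) *m (B *m B) = A.
  have /As0 : forall a, a \in s -> root (q ^+ 2 ^+ 2 - 'X) a.
    move=> a sa; rewrite rootE hornerD hornerN hornerX !horner_exp (qE _ sa).
    have a_ge0 : 0 <= a := ltW (spdmx_eigenvalue_gt0 As (sA _ sa)).
    by rewrite !sqr_sqrtr ?sqrtr_ge0 ?subrr.
  by rewrite rmorphB !rmorphXn /= horner_mx_X => /subr0_eq.
exists (B *m B); split => //; apply: spdmx_sqr => //.
by have := spdmx_unit As; rewrite -B4 !unitmx_mul => /andP[/andP[]].
Qed.

Lemma sqrtmxP {R : realType} {d : nat} {A : 'M[R]_d} :
  spdmx A -> spdmx (sqrtmx A) /\ sqrtmx A *m sqrtmx A = A.
Proof.
move=> As; exact: (xgetPex (P := [set S | spdmx S /\ S *m S = A]) 0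
  (spdmx_sqrt_exists As)).
Qed.

Lemma spdmx_det_gt0 {R : realType} {d : nat} {A : 'M[R]_d} :
  spdmx A -> 0 < \det A.
Proof.
move=> /sqrtmxP[/spdmx_unit Su <-].
by rewrite det_mulmx -expr2 exprn_even_gt0//= -unitfE -unitmxE.
Qed.

(** * Separation of convex hulls *)

Lemma conv_hull_min {R : realType} {d : nat} {A K : set 'cV[R]_d} :
  (forall u v (t : R), K u -> K v -> 0 < t < 1 -> K (t *: u + (1 - t) *: v)) ->
  A `<=` K -> conv_hull A `<=` K.
Proof.
move=> Kconv; apply: smallest_sub; apply/convex_setW => u v.
rewrite !inE => Ku Kv t t0 t1; rewrite inE.
by apply: Kconv; rewrite // t0.
Qed.

(** Each hull is confined to a convex set that contains its generators: an open
    half-space, joined with the common point [a] when there is one. *)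
Lemma conv_hull_separated {R : realType} {d : nat} {w : 'rV[R]_d}
    {A1 A2 : set 'cV[R]_d} :
  (forall u v, A1 u -> A2 v -> u = v \/ (w *m v) 0 0 < (w *m u) 0 0) ->
  conv_hull A1 `&` conv_hull A2 = set0 \/
  exists2 a, (A1 `&` A2) a & conv_hull A1 `&` conv_hull A2 = [set a].
Proof.
pose L (u : 'cV[R]_d) := (w *m u) 0 0 => sep.
have LE t u v : L (t *: u + (1 - t) *: v) = t * L u + (1 - t) * L v.
  by rewrite /L mulmxDr -!scalemxAr !mxE.
have Lt c t u v : 0 < t < 1 -> c < L u -> c < L v ->
    c < L (t *: u + (1 - t) *: v).
  by move=> /andP[t0 t1] cu cv; rewrite LE; nra.
have Gt c t u v : 0 < t < 1 -> L u < c -> L v < c ->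
    L (t *: u + (1 - t) *: v) < c.
  by move=> /andP[t0 t1] cu cv; rewrite LE; nra.
case: (pselect ((A1 `&` A2) !=set0)) => [[a [A1a A2a]]|A12].
  right; exists a => //; apply/seteqP; split=> [z [z1 z2]|_ ->]; last first.
    by split; apply: sub_gen_smallest.
  have : z = a \/ L a < L z.
    apply: (conv_hull_min (K := [set u | u = a \/ L a < L u])) z1.
      move=> u v t Ku Kv t01; have /andP[t0 t1] := t01.
      case: Ku Kv => [->|Lu] [->|Lv]; last by right; exact: Lt.
      - by left; rewrite -scalerDl subrKC scale1r.
      - by right; rewrite LE; nra.
      - by right; rewrite LE; nra.
    by move=> u A1u; exact: sep.
  have : z = a \/ L z < L a.
    apply: (conv_hull_min (K := [set u | u = a \/ L u < L a])) z2.
      move=> u v t Ku Kv t01; have /andP[t0 t1] := t01.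
      case: Ku Kv => [->|Lu] [->|Lv]; last by right; exact: Gt.
      - by left; rewrite -scalerDl subrKC scale1r.
      - by right; rewrite LE; nra.
      - by right; rewrite LE; nra.
    by move=> v A2v; case: (sep a v A1a A2v) => [->|]; [left|right].
  by case=> [-> //|za] [-> //|az]; have := lt_trans za az; rewrite ltxx.
(* Confine the first hull above the generators of the second, then the second
   hull below the points of the first. *)
left; rewrite -subset0 => z [z1 z2].
have hull1 u v : conv_hull A1 u -> A2 v -> L v < L u.
  move=> A1u A2v.
  apply: (conv_hull_min (K := [set u | L v < L u])) A1u
    => [? ? ? ? ?|{}u A1u] /=.
    by move=> *; exact: Lt.
  case: (sep u v A1u A2v) => // uv.
  by case: A12; exists u; split=> //; rewrite uv.
suff : L z < L z by rewrite ltxx.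
apply: (conv_hull_min (K := [set v | L v < L z])) z2 => [? ? ? ? ?|v A2v] /=.
  by move=> *; exact: Gt.
exact: hull1.
Qed.

(** * Exchanging two observations *)

Lemma norm2_sqrD {R : realType} {d : nat} (u v : 'cV[R]_d) (c : R) :
  norm2 (u + c *: v) ^+ 2 =
  norm2 u ^+ 2 + 2 * c * (u^T *m v) 0 0 + c ^+ 2 * norm2 v ^+ 2.
Proof.
rewrite !norm2_sqr [(_ + _)^T]linearD /= [(_ *: _)^T]linearZ /=.
rewrite mulmxDl !mulmxDr -!scalemxAl -!scalemxAr.
have vu : (v^T *m u) 0 0 = (u^T *m v) 0 0.
  by rewrite -[v^T *m u]trmxK [LHS]mxE trmx_mul trmxK.
have entryD (A B : 'M[R]_1) : (A + B) 0 0 = A 0 0 + B 0 0 by rewrite mxE.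
have entryZ (a : R) (A : 'M[R]_1) : (a *: A) 0 0 = a * A 0 0 by rewrite mxE.
rewrite !(entryD, entryZ) vu; ring.
Qed.

Section Exchange.
Context {R : realType} {d : nat} {alpha : R} (T Sigma : 'M[R]_d).

Definition energy_mx (m : nat) : 'M[R]_d :=
  invmx (Rmxn T Sigma m) *m (Rmx Sigma *m Rmx Sigma).

Definition cluster_energy {n : nat} (x : 'I_n -> 'cV[R]_d)
    (J : {set 'I_n}) : R :=
  #|J|%:R * norm2 (energy_mx #|J| *m cluster_mean x J) ^+ 2.

Lemma cluster_mean_perm {n : nat} (x : 'I_n -> 'cV[R]_d) (s : {perm 'I_n})
    (J : {set 'I_n}) :
  cluster_mean x [set s i | i in J]%SET = cluster_mean (x \o s) J.
Proof.
have s_inj := @perm_inj _ s.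
by rewrite /cluster_mean card_imset// big_imset//=; exact: in2W.
Qed.

(** Exchanging two points is carried out by a permutation [s] of the indices,
    and moving the clusters by [s] amounts to relabelling the data. All
    comparisons then take place on the fixed partition [P]. *)
Lemma Qpost_perm {n : nat} (x : 'I_n -> 'cV[R]_d) (s : {perm 'I_n})
    (P : {set {set 'I_n}}) :
  Qpost alpha T Sigma x [set [set s i | i in J] | J : {set 'I_n} in P]%SET =
  Qpost alpha T Sigma (x \o s) P.
Proof.
have s_inj := imset_inj (@perm_inj _ s).
have sC (J : {set 'I_n}) : #|[set s i | i in J]%SET| = #|J|.
  by rewrite card_imset//; exact: perm_inj.
have prodE (F : {set 'I_n} -> R) : \prod_(J in [set [set s i | i in J] |
    J : {set 'I_n} in P]%SET) F J = \prod_(J in P) F [set s i | i in J]%SET.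
  exact: (big_imset F (in2W s_inj)).
have sumE (F : {set 'I_n} -> R) : \sum_(J in [set [set s i | i in J] |
    J : {set 'I_n} in P]%SET) F J = \sum_(J in P) F [set s i | i in J]%SET.
  exact: (big_imset F (in2W s_inj)).
rewrite /Qpost prodE sumE (card_imset _ s_inj).
under eq_bigr do rewrite sC.
by under [in X in expR X]eq_bigr do rewrite sC cluster_mean_perm.
Qed.

Lemma cluster_mean_tperm {n : nat} (x : 'I_n -> 'cV[R]_d) (J : {set 'I_n}) i j :
  i \in J -> j \notin J ->
  cluster_mean (x \o tperm i j) J =
  cluster_mean x J + #|J|%:R^-1 *: (x j - x i).
Proof.
move=> iJ jJ; rewrite /cluster_mean -scalerDr; congr (_ *: _).
rewrite (bigD1 i)//= [in RHS](bigD1 i)//= tpermL addrAC [x i + _]addrC subrK.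
congr (_ + _); apply: eq_bigr => k /andP[kJ ki]; rewrite tpermD 1?eq_sym//.
by apply: contraNneq jJ => <-.
Qed.

Lemma cluster_energy_tperm_out {n : nat} (x : 'I_n -> 'cV[R]_d)
    (J : {set 'I_n}) i j :
  i \notin J -> j \notin J ->
  cluster_energy (x \o tperm i j) J = cluster_energy x J.
Proof.
move=> iJ jJ; rewrite /cluster_energy /cluster_mean.
congr (_ * norm2 (_ *m (_ *: _)) ^+ 2); apply: eq_bigr => k kJ /=.
by rewrite tpermD//; [apply: contraNneq iJ|apply: contraNneq jJ] => ->.
Qed.

Lemma cluster_energy_tperm {n : nat} (x : 'I_n -> 'cV[R]_d)
    (J : {set 'I_n}) i j (M := energy_mx #|J|) :
  i \in J -> j \notin J ->
  cluster_energy (x \o tperm i j) J = cluster_energy x J +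
    2 * ((M *m cluster_mean x J)^T *m M *m (x j - x i)) 0 0 +
    #|J|%:R^-1 * norm2 (M *m (x j - x i)) ^+ 2.
Proof.
move=> iJ jJ; rewrite /cluster_energy cluster_mean_tperm// -/M.
move: (x j - x i) => v.
rewrite mulmxDr -[M *m (_ *: v)]scalemxAr norm2_sqrD -mulmxA.
have J0 : #|J|%:R != 0 :> R.
  by rewrite pnatr_eq0 -lt0n; apply/card_gt0P; exists i.
by field.
Qed.

Hypotheses (alpha_gt0 : 0 < alpha) (T_spd : spdmx T) (Sigma_spd : spdmx Sigma).

Lemma Rmxn_spd {m : nat} : (0 < m)%N -> spdmx (Rmxn T Sigma m).
Proof.
move=> m0; apply: proj1 (sqrtmxP _); apply: spdmxD; first exact: spdmx_inv.
by apply: spdmxZ; rewrite ?invr_gt0 ?ltr0n//; exact: spdmx_inv.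
Qed.

Lemma energy_mx_unit {m : nat} : (0 < m)%N -> energy_mx m \in unitmx.
Proof.
move=> m0; rewrite !unitmx_mul unitmx_inv (spdmx_unit (Rmxn_spd m0)) andbb /=.
exact/spdmx_unit/(proj1 (sqrtmxP _))/spdmx_inv.
Qed.

(** A permutation preserves the number and the sizes of the clusters, hence the
    prefactor of the posterior; being positive, it cancels. *)
Lemma MAP_energy_max {n : nat} {x : 'I_n -> 'cV[R]_d} {P : {set {set 'I_n}}}
    (s : {perm 'I_n}) :
  MAP_partition alpha T Sigma x P ->
  \sum_(J in P) cluster_energy (x \o s) J <= \sum_(J in P) cluster_energy x J.
Proof.
move=> [Ppart Pmax].
have := Pmax [set [set s i | i in J] | J : {set 'I_n} in P]%SET.
rewrite Qpost_perm => /(_ _)/wrap[].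
  have sT : [set s i | i in [set: 'I_n]]%SET = [set: 'I_n]%SET.
    apply/finset.setP => i; rewrite finset.in_setT; apply/imsetP.
    by exists ((s^-1)%g i); rewrite ?finset.in_setT// permKV.
  rewrite -[X in finset.partition _ X]sT.
  by rewrite (imset_partition _ _ (@perm_inj _ s)).
rewrite /Qpost ler_pM2l; last first.
  rewrite mulr_gt0//.
    by rewrite exprn_gt0// divr_gt0// sqrtr_gt0 spdmx_det_gt0.
  rewrite prodr_gt0// => J JP.
  have J0 : (0 < #|J|)%N by rewrite card_gt0 (partition_neq0 Ppart).
  rewrite divr_gt0 ?ltr0n ?fact_gt0// mulr_gt0// ?powR_gt0 ?ltr0n//.
  exact/spdmx_det_gt0/Rmxn_spd.
by rewrite ler_expR ler_pM2l// invr_gt0.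
Qed.

(** The witness [w] is the gradient of the exponent with respect to the sum of
    the observations of [J1], the sum over both clusters being fixed. *)
Lemma MAP_clusters_separated {n : nat} {x : 'I_n -> 'cV[R]_d}
    {P : {set {set 'I_n}}} {J1 J2 : {set 'I_n}} :
  MAP_partition alpha T Sigma x P -> J1 \in P -> J2 \in P -> J1 <> J2 ->
  exists w : 'rV[R]_d, forall i j, i \in J1 -> j \in J2 ->
    x i = x j \/ (w *m x j) 0 0 < (w *m x i) 0 0.
Proof.
move=> PM J1P J2P /eqP J12; have [Ppart _] := PM.
pose M1 := energy_mx #|J1|; pose M2 := energy_mx #|J2|.
pose w1 := (M1 *m cluster_mean x J1)^T *m M1.
pose w2 := (M2 *m cluster_mean x J2)^T *m M2.
exists (w1 - w2) => i j iJ1 jJ2.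
have Pdisj A B k : A \in P -> B \in P -> A != B -> k \in A -> k \notin B.
  move=> AP BP AB kA; apply/negP => kB.
  have /finset.trivIsetP/(_ A B AP BP AB) := partition_trivIset Ppart.
  by move/disjointFr => /(_ _ kA); rewrite kB.
have := MAP_energy_max (tperm i j) PM.
rewrite !(bigD1 J1 J1P)/=.
rewrite !(bigD1 J2 (P := fun J => (J \in P) && (J != J1)))/= ?J2P 1?eq_sym//.
rewrite [X in _ + (_ + X) <= _](eq_bigr (cluster_energy x)); last first.
  move=> J /andP[/andP[JP JJ1] JJ2]; apply: cluster_energy_tperm_out.
    by apply: Pdisj iJ1; rewrite // eq_sym.
  by apply: Pdisj jJ2; rewrite // eq_sym.
rewrite cluster_energy_tperm ?(Pdisj _ _ _ J2P J1P)// 1?eq_sym//.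
rewrite tpermC cluster_energy_tperm ?(Pdisj _ _ _ J1P J2P)//.
rewrite -/M1 -/M2 -/w1 -/w2 => le_x.
clearbody w1 w2.
case: (eqVneq (x i) (x j)) => [|xij]; [by left|right].
have v0 : x j - x i != 0 by rewrite subr_eq0 eq_sym.
have J1c : (0 < #|J1|)%N by apply/card_gt0P; exists i.
have q1 : 0 < #|J1|%:R^-1 * norm2 (M1 *m (x j - x i)) ^+ 2.
  rewrite mulr_gt0 ?invr_gt0 ?ltr0n// norm2_sqr_gt0//.
  apply: contra_neq v0 => Mv.
  by rewrite -[_ - _](mulKmx (energy_mx_unit J1c)) Mv mulmx0.
have q2 : 0 <= #|J2|%:R^-1 * norm2 (M2 *m (x i - x j)) ^+ 2.
  by rewrite mulr_ge0 ?invr_ge0 ?ler0n ?sqr_ge0.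
have entryB (A B : 'M[R]_1) : (A - B) 0 0 = A 0 0 - B 0 0 by rewrite !mxE.
have {le_x q1 q2} :
    2 * (w1 *m (x j - x i)) 0 0 + 2 * (w2 *m (x i - x j)) 0 0 < 0 by lra.
rewrite (mulmxBr w1) (mulmxBr w2) !(mulmxBl w1 w2) !entryB; lra.
Qed.

End Exchange.

Theorem proposition1 (R : realType) (d : nat) (alpha : R) (T Sigma : 'M[R]_d)
    (d_ge1 : (1 <= d)%N) (alpha_gt0 : 0 < alpha)
    (T_spd : spdmx T) (Sigma_spd : spdmx Sigma)
    (x : nat -> 'cV[R]_d) (n : nat) (P : {set {set 'I_n}})
    (P_MAP : MAP_partition alpha T Sigma (fun i : 'I_n => x i) P)
    (J1 J2 : {set 'I_n}) (J1P : J1 \in P) (J2P : J2 \in P) (J12 : J1 <> J2) :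
  let A1 := conv_hull [set x (nat_of_ord i) | i in [set` J1]] in
  let A2 := conv_hull [set x (nat_of_ord i) | i in [set` J2]] in
  A1 `&` A2 = set0 \/ exists i : 'I_n, A1 `&` A2 = [set x i].
Proof.
have [w sep] := MAP_clusters_separated T Sigma alpha_gt0 T_spd Sigma_spd P_MAP
  J1P J2P J12.
set B1 := [set x (nat_of_ord i) | i in [set` J1]].
set B2 := [set x (nat_of_ord i) | i in [set` J2]] => A1 A2.
have /conv_hull_separated[|[_ [[i _ <-] _] A12]] :
    forall u v, B1 u -> B2 v -> u = v \/ (w *m v) 0 0 < (w *m u) 0 0.
- by move=> _ _ [i iJ <-] [j jJ <-]; exact: sep.
- by left.
- by right; exists i.
Qed.
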